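(* Let $\mu\geq\nu>-1$. Then the functions $f_{\mu,\nu},g_{\mu,\nu},q_\nu$ defined on $[0,\alpha_{\nu,1}^2)$ by $$g_{\mu,\nu}(x)=x^{\frac{\nu-\mu}{2}}e^{\frac{3x}{4}\left(\frac{1}{\mu+1}-\frac{1}{\nu+1}\right)}\frac{d_\mu(\sqrt{x})}{d_\nu(\sqrt{x})},\qquad f_{\mu,\nu}(x)=\big(\log g_{\mu,\nu}(x)\big)',\qquad q_\nu(x)=\frac{x^{\nu/2}e^{-\frac{3x}{4(\nu+1)}}}{d_\nu(\sqrt{x})},$$ (with values at $x=0$ understood by continuity) are absolutely monotonic on $[0,\alpha_{\nu,1}^2)$.
   Context: $J_\nu$ denotes the Bessel function of the first kind of order $\nu$. The Dini function is $d_\nu(x)=(1-\nu)J_\nu(x)+xJ_\nu'(x)$, and $0<\alpha_{\nu,1}<\alpha_{\nu,2}<\cdots$ denote its positive zeros. For $x>0$, $x^{s}$ denotes the positive real power. Note $x^{-\nu/2}d_\nu(\sqrt x)$ extends to an entire function of $x$ with value $1/(2^\nu\Gamma(\nu+1))$ at $0$. A function $f:I\to\mathbb{R}$ is absolutely monotonic on an interval $I$ if $f^{(n)}(x)\ge0$ for all $x\in I$ and all $n\in\{0,1,2,\dots\}$. *)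

(* Defs.v *)
From Stdlib Require Import Reals Lra ClassicalEpsilon Factorial.
Open Scope R_scope.

(* Euler's limit formula for Gamma:
   Gamma z = lim_n n! n^z / (z (z+1) ... (z+n)), valid for z > 0. *)
Fixpoint prod_shift (z : R) (n : nat) : R :=
  match n with
  | O => z
  | S m => prod_shift z m * (z + INR (S m))
  end.

Definition gamma_seq (z : R) (n : nat) : R :=
  INR (fact n) * Rpower (INR n) z / prod_shift z n.

Definition Gamma (z : R) : R :=
  epsilon (inhabits 0) (fun l => Un_cv (gamma_seq z) l).

(* Bessel function of the first kind, for x > 0 (real power (x/2)^(2k+nu)). *)
Definition bessel_term (nu x : R) (k : nat) : R :=
  (-1) ^ k * Rpower (x / 2) (2 * INR k + nu) / (INR (fact k) * Gamma (INR k + nu + 1)).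

Definition BesselJ (nu x : R) : R :=
  epsilon (inhabits 0) (fun s => infinite_sum (bessel_term nu x) s).

Definition derivR (f : R -> R) (x : R) : R :=
  epsilon (inhabits 0) (fun l => derivable_pt_lim f x l).

Definition dini (nu x : R) : R :=
  (1 - nu) * BesselJ nu x + x * derivR (BesselJ nu) x.

Definition first_pos_zero (f : R -> R) (a : R) : Prop :=
  0 < a /\ f a = 0 /\ (forall y, 0 < y < a -> f y <> 0).

Definition extend0 (h : R -> R) (x : R) : R :=
  if Rlt_dec 0 x then h x
  else epsilon (inhabits 0) (fun l => limit1_in h (fun t => 0 < t) l 0).

(* F' is the derivative of F on the interval I (one-sided at endpoints in I) *)
Definition is_deriv_on (I : R -> Prop) (F F' : R -> R) : Prop :=
  forall x, I x ->
    limit1_in (fun h => (F (x + h) - F x) / h) (fun h => h <> 0 /\ I (x + h)) (F' x) 0.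

Definition abs_monotonic (I : R -> Prop) (f : R -> R) : Prop :=
  exists F : nat -> R -> R,
    (forall x, I x -> F O x = f x) /\
    (forall n, is_deriv_on I (F n) (F (S n))) /\
    (forall n x, I x -> 0 <= F n x).

Definition g_fun (mu nu x : R) : R :=
  Rpower x ((nu - mu) / 2) * exp (3 * x / 4 * (1 / (mu + 1) - 1 / (nu + 1)))
  * dini mu (sqrt x) / dini nu (sqrt x).

Definition f_fun (mu nu x : R) : R := derivR (fun t => ln (g_fun mu nu t)) x.

Definition q_fun (nu x : R) : R :=
  Rpower x (nu / 2) * exp (- (3 * x) / (4 * (nu + 1))) / dini nu (sqrt x).

(* Main.v *)
Require Import Defs.
From Stdlib Require Import Reals Lra Lia Arith Factorial ClassicalEpsilon.
From Coquelicot Require Import Coquelicot.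
Open Scope R_scope.

(* Write J_nu(x) = (x/2)^nu / Gamma(nu+1) * u(x^2) with u entire, so that, up to a positive
   constant, x^(-nu/2) d_nu(sqrt x) is lam = u + 2 x u'.  The function W = - u'/u solves the
   Riccati equation x W' + (nu+1) W = 1/4 + x W^2, hence its Taylor coefficients satisfy
   Kishore's convolution recursion, which shows that they are nonnegative and decrease in nu.
   The Taylor polynomials of W are subsolutions of the Riccati equation, so they stay below
   - u'/u as long as lam > 0: this makes the Taylor series of W converge on [0, alpha_1^2) and
   replaces any information on the zeros.

   With v = 2 x W < 1 we have lam = u (1 - v) and - lam'/lam = W + v'/(1 - v) =: P.  The class of
   pairs of functions generated from power series with ordered nonnegative coefficients and
   from 1/(1 - v) by sums and products is closed under differentiation, so P_nu - P_mu is
   absolutely monotonic.  Finally (log g)' and (log q)' are P_nu - P_mu and P_nu, minus their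
   values at 0, and g' = f g propagates absolute monotonicity from f to g. *)

(** * The Gamma function *)

Lemma prod_shift_pos (z : R) (n : nat) : 0 < z -> 0 < prod_shift z n.
Proof.
  intros Hz; induction n as [|n IH]; [exact Hz|].
  cbn [prod_shift]; apply Rmult_lt_0_compat; [exact IH|].
  pose proof (pos_INR (S n)); lra.
Qed.

Lemma prod_shift_step (z : R) (n : nat) :
  z * prod_shift (z + 1) n = prod_shift z n * (z + INR (S n)).
Proof.
  induction n as [|n IH]; [cbn; ring|].
  cbn [prod_shift].
  rewrite <- Rmult_assoc, IH; cbn [prod_shift].
  rewrite (S_INR (S n)); ring.
Qed.

Lemma gamma_seq_pos (z : R) (n : nat) : 0 < z -> 0 < gamma_seq z n.
Proof.
  intros Hz; unfold gamma_seq, Rdiv, Rpower.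
  apply Rmult_lt_0_compat.
  - apply Rmult_lt_0_compat; [apply lt_0_INR, lt_O_fact | apply exp_pos].
  - apply Rinv_0_lt_compat, prod_shift_pos, Hz.
Qed.

Lemma exp_le_compat (x y : R) : x <= y -> exp x <= exp y.
Proof.
  intros [H|H]; [left; apply exp_increasing, H | rewrite H; apply Rle_refl].
Qed.

Lemma ln_le_minus_one (x : R) : 0 < x -> ln x <= x - 1.
Proof.
  intros Hx; pose proof (exp_ineq1_le (ln x)) as H.
  rewrite exp_ln in H by exact Hx; lra.
Qed.

Lemma ln_succ_bounds (x : R) : 0 < x -> / (x + 1) <= ln (x + 1) - ln x <= / x.
Proof.
  intros Hx; split.
  - pose proof (ln_le_minus_one (x / (x + 1))) as H.
    rewrite ln_div in H by lra.
    assert (0 < x / (x + 1)) by (apply Rdiv_lt_0_compat; lra).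
    replace (x / (x + 1) - 1) with (- / (x + 1)) in H by (field; lra); lra.
  - pose proof (ln_le_minus_one ((x + 1) / x)) as H.
    rewrite ln_div in H by lra.
    assert (0 < (x + 1) / x) by (apply Rdiv_lt_0_compat; lra).
    replace ((x + 1) / x - 1) with (/ x) in H by (field; lra); lra.
Qed.

Lemma gamma_seq_succ (z : R) (n : nat) : 0 < z ->
  let x := INR (S n) in
  gamma_seq z (S (S n))
  = gamma_seq z (S n) * (exp (z * (ln (x + 1) - ln x)) * ((x + 1) / (z + x + 1))).
Proof.
  intros Hz x.
  assert (Hx : 0 < x) by (apply lt_0_INR; lia).
  unfold gamma_seq.
  rewrite fact_simpl, mult_INR, (S_INR (S n)).
  change (prod_shift z (S (S n))) with (prod_shift z (S n) * (z + INR (S (S n)))).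
  rewrite (S_INR (S n)); fold x.
  pose proof (prod_shift_pos z (S n) Hz).
  unfold Rpower; rewrite Rmult_minus_distr_l; unfold Rminus.
  rewrite exp_plus, exp_Ropp.
  pose proof (exp_pos (z * ln x)).
  field; lra.
Qed.

(** With [x = n + 1], the ratio of consecutive terms is [exp (z * (ln (x + 1) - ln x))] divided by
    [1 + z / (x + 1)], and the exponential is at least [exp (z / (x + 1))]. *)
Lemma gamma_seq_growing (z : R) (n : nat) : 0 < z ->
  gamma_seq z (S n) <= gamma_seq z (S (S n)).
Proof.
  intros Hz; rewrite gamma_seq_succ by exact Hz.
  set (x := INR (S n)).
  assert (Hx : 0 < x) by (apply lt_0_INR; lia).
  pose proof (gamma_seq_pos z (S n) Hz).
  rewrite <- (Rmult_1_r (gamma_seq z (S n))) at 1.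
  apply Rmult_le_compat_l; [lra|].
  apply Rmult_le_reg_r with ((z + x + 1) / (x + 1)); [apply Rdiv_lt_0_compat; lra|].
  replace (exp (z * (ln (x + 1) - ln x)) * ((x + 1) / (z + x + 1)) * ((z + x + 1) / (x + 1)))
    with (exp (z * (ln (x + 1) - ln x))) by (field; lra).
  eapply Rle_trans; [|apply exp_ineq1_le].
  replace (1 * ((z + x + 1) / (x + 1))) with (1 + z * / (x + 1)) by (field; lra).
  apply Rplus_le_compat_l, Rmult_le_compat_l; [lra|].
  apply ln_succ_bounds, Hx.
Qed.

(* The quotient of consecutive terms is at most [exp (c / n - c / (n + 1))]
   with [c = z (z + 1)], so the bound telescopes. *)
Lemma gamma_seq_damped_decreasing (z : R) (n : nat) : 0 < z ->
  gamma_seq z (S (S n)) * exp (z * (z + 1) / INR (S (S n)))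
  <= gamma_seq z (S n) * exp (z * (z + 1) / INR (S n)).
Proof.
  intros Hz; rewrite gamma_seq_succ by exact Hz.
  rewrite (S_INR (S n)); set (x := INR (S n)).
  assert (Hx : 0 < x) by (apply lt_0_INR; lia).
  pose proof (gamma_seq_pos z (S n) Hz).
  rewrite Rmult_assoc; apply Rmult_le_compat_l; [lra|].
  assert (E1 : (x + 1) / (z + x + 1) <= exp (- (z / (z + x + 1)))).
  { eapply Rle_trans; [|apply exp_ineq1_le].
    right; field; lra. }
  assert (E2 : exp (z * (ln (x + 1) - ln x)) <= exp (z * / x)).
  { apply exp_le_compat, Rmult_le_compat_l; [lra|]. apply ln_succ_bounds, Hx. }
  apply Rle_trans with
    (exp (z * / x) * exp (- (z / (z + x + 1))) * exp (z * (z + 1) / (x + 1))).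
  - apply Rmult_le_compat_r; [left; apply exp_pos|].
    apply Rmult_le_compat; try assumption; [left; apply exp_pos|].
    left; apply Rdiv_lt_0_compat; lra.
  - rewrite <- !exp_plus; apply exp_le_compat.
    assert (E : z * (z + 1) / x
      = z * / x + - (z / (z + x + 1)) + z * (z + 1) / (x + 1)
        + z * (z + 1) * z / (x * (x + 1) * (z + x + 1))) by (field; lra).
    rewrite E.
    assert (0 <= z * (z + 1) * z / (x * (x + 1) * (z + x + 1))); [|lra].
    left; apply Rdiv_lt_0_compat; repeat apply Rmult_lt_0_compat; lra.
Qed.

(** From index 1 on the sequence increases and lies below its damped version, which decreases and so
    stays below its own first term. *)
Lemma gamma_seq_cv (z : R) : 0 < z -> exists l, Un_cv (gamma_seq z) l.
Proof.
  intros Hz.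
  set (c := z * (z + 1)).
  assert (H : ex_finite_lim_seq (fun n => gamma_seq z (S n))).
  { apply ex_finite_lim_seq_incr with (gamma_seq z 1 * exp (c / INR 1)).
    - intros n; apply gamma_seq_growing, Hz.
    - intros n; apply Rle_trans with (gamma_seq z (S n) * exp (c / INR (S n))).
      + pose proof (gamma_seq_pos z (S n) Hz).
        rewrite <- (Rmult_1_r (gamma_seq z (S n))) at 1.
        apply Rmult_le_compat_l; [lra|].
        rewrite <- exp_0; apply exp_le_compat.
        left; apply Rdiv_lt_0_compat; [apply Rmult_lt_0_compat; lra|].
        apply lt_0_INR; lia.
      + induction n as [|n IH]; [lra|].
        eapply Rle_trans; [apply gamma_seq_damped_decreasing, Hz | exact IH]. }
  destruct H as [l Hl]; exists l.
  apply is_lim_seq_Reals; apply is_lim_seq_incr_1; exact Hl.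
Qed.

Lemma Gamma_cv (z : R) : 0 < z -> Un_cv (gamma_seq z) (Gamma z).
Proof.
  intros Hz; unfold Gamma; apply epsilon_spec, gamma_seq_cv, Hz.
Qed.

Lemma Gamma_pos (z : R) : 0 < z -> 0 < Gamma z.
Proof.
  intros Hz.
  apply Rlt_le_trans with (gamma_seq z 1); [apply gamma_seq_pos, Hz|].
  pose proof (Gamma_cv z Hz) as H.
  apply is_lim_seq_Reals, is_lim_seq_incr_1 in H.
  apply (is_lim_seq_incr_compare _ _ H (fun n => gamma_seq_growing z n Hz) 0%nat).
Qed.

(** For [n >= 1], [gamma_seq (z + 1) n] is [z * gamma_seq z n] times [n / (n + z + 1)], a factor
    that tends to 1; it is written as [1 - (z + 1) / (n + z + 1)] to take the limit. *)
Lemma Gamma_succ (z : R) : 0 < z -> Gamma (z + 1) = z * Gamma z.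
Proof.
  intros Hz.
  apply (UL_sequence (gamma_seq (z + 1))); [apply Gamma_cv; lra|].
  apply is_lim_seq_Reals, is_lim_seq_incr_1.
  assert (Hq : is_lim_seq (fun n => 1 - (z + 1) / (INR (S n) + (z + 1))) 1).
  { replace (Finite 1) with (Rbar_plus 1 (Rbar_opp 0)) by (cbn; f_equal; ring).
    apply is_lim_seq_minus'; [apply is_lim_seq_const|].
    replace 0 with ((z + 1) * 0) by ring.
    apply (is_lim_seq_scal_l _ (z + 1) 0).
    replace (Finite 0) with (Rbar_inv p_infty) by reflexivity.
    apply is_lim_seq_inv; [|discriminate].
    eapply is_lim_seq_plus; [apply (is_lim_seq_incr_1 INR p_infty), is_lim_seq_INR
      | apply is_lim_seq_const | reflexivity]. }
  apply is_lim_seq_ext with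
    (fun n => z * gamma_seq z (S n) * (1 - (z + 1) / (INR (S n) + (z + 1)))).
  - intros n; unfold gamma_seq.
    pose proof (prod_shift_step z (S n)) as E.
    pose proof (prod_shift_pos z (S n) Hz) as P1.
    pose proof (prod_shift_pos (z + 1) (S n) ltac:(lra)) as P2.
    rewrite (S_INR (S n)) in E.
    assert (Hn : 0 < INR (S n)) by (apply lt_0_INR; lia).
    replace (prod_shift (z + 1) (S n))
      with (prod_shift z (S n) * (z + (INR (S n) + 1)) / z) by (rewrite <- E; field; lra).
    rewrite Rpower_plus, Rpower_1 by exact Hn.
    field; lra.
  - replace (Finite (z * Gamma z)) with (Finite (z * Gamma z * 1)) by (f_equal; ring).
    apply is_lim_seq_mult'; [|exact Hq].
    apply (is_lim_seq_scal_l _ z (Gamma z)).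
    apply (is_lim_seq_incr_1 (gamma_seq z)), is_lim_seq_Reals, Gamma_cv, Hz.
Qed.

(** * Absolute monotonicity *)

Lemma derive_nonneg_le (f df : R -> R) (a b : R) : a <= b ->
  (forall x, a <= x <= b -> is_derive f x (df x)) ->
  (forall x, a < x < b -> 0 <= df x) -> f a <= f b.
Proof.
  intros [Hab| ->] D H; [|lra].
  destruct (MVT_cor2 f df a b Hab) as [c [E Hc]].
  - intros c Hc; apply is_derive_Reals, D, Hc.
  - specialize (H c Hc); nra.
Qed.

(* The greatest set of functions that are nonnegative on [I] and have a
   derivative in the set; members are produced by exhibiting one such set. *)
Definition abs_mono (I : R -> Prop) (f : R -> R) : Prop :=
  exists S : (R -> R) -> Prop, S f /\
    forall g, S g -> (forall x, I x -> 0 <= g x) /\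
      exists g', S g' /\ forall x, I x -> is_derive g x (g' x).

Lemma is_derive_is_deriv_on (I : R -> Prop) (F F' : R -> R) :
  (forall x, I x -> is_derive F x (F' x)) -> is_deriv_on I F F'.
Proof.
  intros H x Hx eps Heps.
  destruct (proj1 (is_derive_Reals _ _ _) (H x Hx) eps Heps) as [d Hd].
  exists d; split; [apply cond_pos|].
  intros h [[Hh _] Hhd]; cbn in *; unfold Rdist in *.
  apply Hd; [exact Hh|]. now rewrite Rminus_0_r in Hhd.
Qed.

(** Choosing a derivative inside the witnessing set, again and again, yields the sequence of
    successive derivatives. *)
Lemma abs_mono_monotonic (I : R -> Prop) (f h : R -> R) :
  abs_mono I h -> (forall x, I x -> h x = f x) -> abs_monotonic I f.
Proof.
  intros [S [Sh HS]] Hhf.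
  assert (step : forall g : {g | S g}, {g' : {g | S g} |
            forall x, I x -> is_derive (proj1_sig g) x (proj1_sig g' x)}).
  { intros [g Sg].
    apply constructive_indefinite_description.
    destruct (HS g Sg) as [_ [g' [Sg' D]]].
    now exists (exist _ g' Sg'). }
  set (F := fix F n : {g | S g} := match n with
            | O => exist _ h Sh
            | Datatypes.S n => proj1_sig (step (F n)) end).
  exists (fun n => proj1_sig (F n)); split; [|split].
  - intros x Hx; apply Hhf, Hx.
  - intros n; apply is_derive_is_deriv_on; apply (proj2_sig (step (F n))).
  - intros n; apply (HS _ (proj2_sig (F n))).
Qed.

Lemma abs_mono_cons (I : R -> Prop) (f f' : R -> R) :
  (forall x, I x -> 0 <= f x) -> (forall x, I x -> is_derive f x (f' x)) ->
  abs_mono I f' -> abs_mono I f.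
Proof.
  intros Hf D [S [Sf' HS]].
  exists (fun g => g = f \/ S g); split; [now left|].
  intros g [->|Sg].
  - split; [exact Hf|]. exists f'; auto.
  - destruct (HS g Sg) as [H [g' [Sg' D']]]; split; [exact H|].
    exists g'; auto.
Qed.

(** Sums and products of [G] and members of [S]. If [S] is stable under differentiation and
    [G' = f G] with [f] in [S], this set is stable too, which is how positivity passes from [f] to
    all derivatives of [G]. *)
Inductive exp_closure (S : (R -> R) -> Prop) (G : R -> R) : (R -> R) -> Prop :=
| ec_base : exp_closure S G G
| ec_in f : S f -> exp_closure S G f
| ec_plus f g : exp_closure S G f -> exp_closure S G g ->
    exp_closure S G (fun x => f x + g x)
| ec_mult f g : exp_closure S G f -> exp_closure S G g ->
    exp_closure S G (fun x => f x * g x).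

Lemma abs_mono_logder (I : R -> Prop) (f G : R -> R) :
  abs_mono I f -> (forall x, I x -> 0 <= G x) ->
  (forall x, I x -> is_derive G x (f x * G x)) -> abs_mono I G.
Proof.
  intros [S [Sf HS]] HG D.
  exists (exp_closure S G); split; [constructor|].
  intros g Hg; induction Hg as [|g Sg|f1 f2 H1 [P1 [d1 [S1 D1]]] H2 [P2 [d2 [S2 D2]]]
                               |f1 f2 H1 [P1 [d1 [S1 D1]]] H2 [P2 [d2 [S2 D2]]]].
  - split; [exact HG|]. exists (fun x => f x * G x); split; [|exact D].
    apply ec_mult; [now apply ec_in | apply ec_base].
  - destruct (HS g Sg) as [H [g' [Sg' D']]]; split; [exact H|].
    exists g'; split; [now apply ec_in | exact D'].
  - split; [intros x Hx; specialize (P1 x Hx); specialize (P2 x Hx); lra|].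
    exists (fun x => d1 x + d2 x); split; [now apply ec_plus|].
    intros x Hx; apply (is_derive_plus f1 f2); auto.
  - split; [intros x Hx; apply Rmult_le_pos; auto|].
    exists (fun x => d1 x * f2 x + f1 x * d2 x); split.
    + apply ec_plus; apply ec_mult; assumption.
    + intros x Hx; apply (is_derive_mult f1 f2); auto. intros; apply Rmult_comm.
Qed.

(** * Power series *)

Lemma CV_radius_ge (a : nat -> R) (r : R) :
  (forall x, 0 <= x < r -> exists M, forall n, Rabs (a n * x ^ n) <= M) ->
  Rbar_le r (CV_radius a).
Proof.
  intros H.
  destruct (CV_radius_bounded a) as [ub _].
  destruct (CV_radius a) as [c| |] eqn:E; cbn; auto.
  - destruct (Rle_lt_dec r c) as [|Hc]; [assumption|].
    pose proof (CV_radius_ge_0 a) as H0; rewrite E in H0; cbn in H0.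
    (* If [c < r], the terms are bounded at the midpoint of [c] and [r], which lies beyond the
       radius [c]. *)
    assert (Hm : 0 <= (c + r) / 2 < r) by lra.
    specialize (ub _ (H _ Hm)); cbn in ub; lra.
  - pose proof (CV_radius_ge_0 a) as H0; rewrite E in H0; exact H0.
Qed.

Lemma Rabs_lt_CV_radius (a : nat -> R) (r x : R) :
  Rbar_le r (CV_radius a) -> 0 <= x < r -> Rbar_lt (Rabs x) (CV_radius a).
Proof.
  intros H Hx; rewrite Rabs_pos_eq by lra.
  apply Rbar_lt_le_trans with r; [apply Hx | exact H].
Qed.

Lemma CV_radius_le_compat (a b : nat -> R) (r : R) :
  (forall n, 0 <= b n <= a n) -> Rbar_le r (CV_radius a) -> Rbar_le r (CV_radius b).
Proof.
  intros Hab Ha; apply CV_radius_ge; intros x Hx.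
  pose proof (CV_disk_inside a x (Rabs_lt_CV_radius a r x Ha Hx)) as Hs.
  apply ex_series_lim_0, is_lim_seq_Reals in Hs.
  destruct (maj_by_pos _ (exist _ 0 Hs)) as [M [_ HM]].
  exists M; intros n; eapply Rle_trans; [|apply (HM n)].
  rewrite Rabs_Rabsolu, !Rabs_mult.
  apply Rmult_le_compat_r; [apply Rabs_pos|].
  specialize (Hab n); rewrite !Rabs_pos_eq; lra.
Qed.

Lemma PSeries_le (a b : nat -> R) (r x : R) :
  (forall n, 0 <= b n <= a n) -> Rbar_le r (CV_radius a) -> 0 <= x < r ->
  0 <= PSeries b x <= PSeries a x.
Proof.
  intros Hab Ha Hx.
  assert (E : forall c, Rbar_le r (CV_radius c) ->
              ex_series (fun n => c n * x ^ n)).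
  { intros c Hc; apply ex_pseries_R, CV_radius_inside.
    exact (Rabs_lt_CV_radius c r x Hc Hx). }
  assert (P : forall n, 0 <= x ^ n) by (intros; apply pow_le; lra).
  split.
  - rewrite <- (PSeries_const_0 x); apply Series_le.
    + intros n; specialize (Hab n); specialize (P n); nra.
    + apply E; now apply CV_radius_le_compat with a.
  - apply Series_le.
    + intros n; specialize (Hab n); specialize (P n); nra.
    + now apply E.
Qed.

(** * Ordered pairs of functions closed under differentiation *)

(* [dini_P s] is [- lam' / lam] for [lam = u (1 - v)], where [- u' / u = PSeries s] and
   [v = 2 x * PSeries s]. *)
Definition dini_v (s : nat -> R) : nat -> R := PS_incr_1 (PS_scal 2 s).

Definition dini_P (s : nat -> R) (x : R) : R :=
  PSeries s x + PSeries (PS_derive (dini_v s)) x * / (1 - PSeries (dini_v s) x).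

Lemma dini_v_nonneg_le (s t : nat -> R) :
  (forall n, 0 <= t n <= s n) -> forall n, 0 <= dini_v t n <= dini_v s n.
Proof.
  intros H [|n]; unfold dini_v, PS_incr_1, PS_scal; cbn; [lra|].
  specialize (H n); unfold scal; cbn; unfold mult; cbn; lra.
Qed.

Lemma CV_radius_dini_v (s : nat -> R) : CV_radius (dini_v s) = CV_radius s.
Proof.
  unfold dini_v; rewrite CV_radius_incr_1; apply CV_radius_scal; lra.
Qed.

Lemma PSeries_dini_v (s : nat -> R) (x : R) :
  PSeries (dini_v s) x = 2 * x * PSeries s x.
Proof. unfold dini_v; rewrite PSeries_incr_1, PSeries_scal; ring. Qed.

(** Both components are built by the same expression, the first from the larger data and the second
    from the smaller. Every constructor preserves [0 <= g <= f], and differentiation acts on both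
    sides alike, so all derivatives of [f - g] are nonnegative. *)
Inductive pair_closure (r : R) (vs vt : R -> R) : (R -> R) -> (R -> R) -> Prop :=
| pc_series a b : (forall n, 0 <= b n <= a n) -> Rbar_le r (CV_radius a) ->
    pair_closure r vs vt (PSeries a) (PSeries b)
| pc_inv : pair_closure r vs vt (fun x => / (1 - vs x)) (fun x => / (1 - vt x))
| pc_plus f1 g1 f2 g2 : pair_closure r vs vt f1 g1 -> pair_closure r vs vt f2 g2 ->
    pair_closure r vs vt (fun x => f1 x + f2 x) (fun x => g1 x + g2 x)
| pc_mult f1 g1 f2 g2 : pair_closure r vs vt f1 g1 -> pair_closure r vs vt f2 g2 ->
    pair_closure r vs vt (fun x => f1 x * f2 x) (fun x => g1 x * g2 x).

Lemma PS_derive_nonneg_le (s t : nat -> R) :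
  (forall n, 0 <= t n <= s n) -> forall n, 0 <= PS_derive t n <= PS_derive s n.
Proof.
  intros H n; unfold PS_derive.
  specialize (H (S n)); pose proof (pos_INR (S n)); nra.
Qed.

Section DiniPair.

Variables (r : R) (s t : nat -> R).
Hypothesis Hst : forall n, 0 <= t n <= s n.
Hypothesis Hr : Rbar_le r (CV_radius s).
Hypothesis Hv : forall x, 0 <= x < r -> PSeries (dini_v s) x < 1.

Let pc := pair_closure r (PSeries (dini_v s)) (PSeries (dini_v t)).

Lemma dini_v_bounds (x : R) : 0 <= x < r ->
  0 <= PSeries (dini_v t) x <= PSeries (dini_v s) x.
Proof.
  intros Hx; apply PSeries_le with r; [now apply dini_v_nonneg_le| |exact Hx].
  now rewrite CV_radius_dini_v.
Qed.

Lemma pair_closure_le (f g : R -> R) (x : R) :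
  pc f g -> 0 <= x < r -> 0 <= g x <= f x.
Proof.
  intros H Hx; induction H as [a b Hab Ha| |f1 g1 f2 g2 _ IH1 _ IH2|f1 g1 f2 g2 _ IH1 _ IH2].
  - now apply PSeries_le with r.
  - pose proof (dini_v_bounds x Hx); specialize (Hv x Hx); split.
    + left; apply Rinv_0_lt_compat; lra.
    + apply Rinv_le_contravar; lra.
  - lra.
  - split; [apply Rmult_le_pos; lra | apply Rmult_le_compat; lra].
Qed.

Lemma pair_closure_derive (f g : R -> R) : pc f g ->
  exists f' g', pc f' g' /\
    forall x, 0 <= x < r -> is_derive f x (f' x) /\ is_derive g x (g' x).
Proof.
  assert (HS : forall a b, (forall n, 0 <= b n <= a n) -> Rbar_le r (CV_radius a) ->
    pc (PSeries (PS_derive a)) (PSeries (PS_derive b)) /\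
    forall x, 0 <= x < r -> is_derive (PSeries a) x (PSeries (PS_derive a) x)
                         /\ is_derive (PSeries b) x (PSeries (PS_derive b) x)).
  { intros a b Hab Ha; split.
    - apply pc_series; [now apply PS_derive_nonneg_le | now rewrite CV_radius_derive].
    - intros x Hx; split; apply is_derive_PSeries; apply Rabs_lt_CV_radius with r; auto.
      now apply CV_radius_le_compat with a. }
  intros H; induction H as [a b Hab Ha| |f1 g1 f2 g2 P1 [f1' [g1' [D1 IH1]]] P2 [f2' [g2' [D2 IH2]]]
    |f1 g1 f2 g2 P1 [f1' [g1' [D1 IH1]]] P2 [f2' [g2' [D2 IH2]]]].
  - destruct (HS a b Hab Ha) as [H1 H2]; eauto.
  - destruct (HS (dini_v s) (dini_v t)) as [H1 H2];
      [now apply dini_v_nonneg_le | now rewrite CV_radius_dini_v|].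
    eexists _, _; split.
    (* The derivative of [1 / (1 - v)] is [v'] times the square of [1 / (1 - v)], and [v'] is again
       a power series. *)
    + apply pc_mult; [exact H1|]. apply pc_mult; apply pc_inv.
    + intros x Hx; destruct (H2 x Hx) as [E1 E2].
      pose proof (dini_v_bounds x Hx); specialize (Hv x Hx).
      assert (E : forall h l, h x < 1 -> is_derive h x l ->
                is_derive (fun x => / (1 - h x)) x (l * (/ (1 - h x) * / (1 - h x)))).
      { intros h l Hh D.
        replace (l * (/ (1 - h x) * / (1 - h x)))
          with (- (0 - l) / (1 - h x) ^ 2) by (field; lra).
        apply (is_derive_inv (fun x => 1 - h x)); [|lra].
        apply (is_derive_minus (fun _ => 1) h); [apply (is_derive_const 1) | exact D]. }
      split; apply E; auto; lra.
  - exists (fun x => f1' x + f2' x), (fun x => g1' x + g2' x).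
    split; [now apply pc_plus|].
    intros x Hx; destruct (IH1 x Hx), (IH2 x Hx).
    split; [apply (is_derive_plus f1 f2) | apply (is_derive_plus g1 g2)]; assumption.
  - exists (fun x => f1' x * f2 x + f1 x * f2' x), (fun x => g1' x * g2 x + g1 x * g2' x).
    split; [apply pc_plus; apply pc_mult; assumption|].
    intros x Hx; destruct (IH1 x Hx), (IH2 x Hx).
    split; [apply (is_derive_mult f1 f2) | apply (is_derive_mult g1 g2)];
      auto; intros; apply Rmult_comm.
Qed.

(** Derivatives of the difference are differences of pairs in the closure, hence nonnegative. The
    function itself, with its value at 0 subtracted, vanishes at 0 and is nonnegative because it is
    nondecreasing. *)
Lemma abs_mono_dini_P_diff :
  abs_mono (fun x => 0 <= x < r)
    (fun x => (dini_P s x - dini_P t x) - (dini_P s 0 - dini_P t 0)).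
Proof.
  assert (HA : pc (dini_P s) (dini_P t)).
  { apply pc_plus; [now apply pc_series|].
    apply pc_mult; [|apply pc_inv].
    apply pc_series.
    - apply PS_derive_nonneg_le. now apply dini_v_nonneg_le.
    - now rewrite CV_radius_derive, CV_radius_dini_v. }
  destruct (pair_closure_derive _ _ HA) as [A [B [HAB D]]].
  assert (D' : forall x, 0 <= x < r ->
    is_derive (fun x => (dini_P s x - dini_P t x) - (dini_P s 0 - dini_P t 0)) x (A x - B x)).
  { intros x Hx; destruct (D x Hx) as [D1 D2].
    replace (A x - B x) with ((A x - B x) - 0) by ring.
    apply (is_derive_minus (fun x => dini_P s x - dini_P t x)
             (fun _ => dini_P s 0 - dini_P t 0)).
    - now apply (is_derive_minus (dini_P s) (dini_P t)).
    - apply (is_derive_const (dini_P s 0 - dini_P t 0)). }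
  apply abs_mono_cons with (fun x => A x - B x); [|exact D'|].
  - intros x Hx.
    pose proof (derive_nonneg_le _ _ 0 x (proj1 Hx) (fun y Hy => D' y ltac:(lra))
      (fun y Hy => ltac:(pose proof (pair_closure_le _ _ y HAB ltac:(lra)); lra))) as H.
    cbv beta in H; lra.
  - exists (fun h => exists f g, pc f g /\ h = (fun x => f x - g x)).
    split; [eauto|].
    intros h [f [g [Hfg ->]]]; split.
    + intros x Hx; pose proof (pair_closure_le _ _ x Hfg Hx); lra.
    + destruct (pair_closure_derive _ _ Hfg) as [f' [g' [H D2]]].
      exists (fun x => f' x - g' x); split; [eauto|].
      intros x Hx; destruct (D2 x Hx); now apply (is_derive_minus f g).
Qed.

End DiniPair.

(** * Term bounds, integration, and comparison at a singular point *)

Lemma PSeries_ge_term (a : nat -> R) (r x : R) (n : nat) :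
  (forall n, 0 <= a n) -> Rbar_le r (CV_radius a) -> 0 <= x < r ->
  a n * x ^ n <= PSeries a x.
Proof.
  intros Ha Hr Hx.
  assert (P : forall k, 0 <= a k * x ^ k).
  { intros k; apply Rmult_le_pos; [apply Ha | apply pow_le; lra]. }
  assert (H : ex_series (fun k => a k * x ^ k)).
  { apply (ex_pseries_R a x), CV_radius_inside. exact (Rabs_lt_CV_radius a r x Hr Hx). }
  apply Series_correct in H.
  apply Rle_trans with (sum_f_R0 (fun k => a k * x ^ k) n).
  - destruct n as [|n]; [cbn [sum_f_R0]; lra|].
    pose proof (cond_pos_sum _ n P); cbn [sum_f_R0]; lra.
  - rewrite <- sum_n_Reals.
    refine (is_lim_seq_incr_compare (sum_n (fun k => a k * x ^ k)) _ H _ n).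
    intros k; rewrite !sum_n_Reals; cbn [sum_f_R0]; specialize (P (S k)); lra.
Qed.

Lemma is_derive_PS_Int (a : nat -> R) (r x : R) :
  Rbar_le r (CV_radius a) -> 0 <= x < r ->
  is_derive (PSeries (PS_Int a)) x (PSeries a x).
Proof.
  intros Hr Hx; pose proof (Rabs_lt_CV_radius a r x Hr Hx).
  replace (PSeries a x) with (PSeries (PS_derive (PS_Int a)) x).
  - apply is_derive_PSeries; now rewrite CV_radius_Int.
  - apply PSeries_ext; intros n; unfold PS_derive, PS_Int.
    pose proof (lt_0_INR (S n) ltac:(lia)); field; lra.
Qed.

Lemma PS_mult_nonneg (a b : nat -> R) (n : nat) :
  (forall k, 0 <= a k) -> (forall k, 0 <= b k) -> 0 <= PS_mult a b n.
Proof.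
  intros Ha Hb; apply cond_pos_sum; intros k; apply Rmult_le_pos; auto.
Qed.

(* Comparison at the regular singular point [0]: [t ^ c * psi] is nonincreasing. *)
Lemma singular_compare (c r : R) (psi dpsi : R -> R) :
  0 <= c -> psi 0 <= 0 ->
  (forall x, 0 <= x < r -> is_derive psi x (dpsi x)) ->
  (forall x, 0 < x < r -> x * dpsi x <= - c * psi x) ->
  forall x, 0 <= x < r -> psi x <= 0.
Proof.
  intros Hc H0 D H x Hx.
  destruct (Rle_lt_dec (psi x) 0) as [|Hp]; [assumption|exfalso].
  assert (Hx0 : 0 < x) by (destruct (Req_dec x 0) as [->|]; lra).
  assert (M : forall t, 0 < t <= x -> Rpower x c * psi x <= Rpower t c * psi t).
  { intros t Ht.
    apply Ropp_le_cancel.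
    apply (derive_nonneg_le (fun y => - (Rpower y c * psi y))
      (fun y => - (c * Rpower y (c - 1) * psi y + Rpower y c * dpsi y))); [lra| |].
    - intros y Hy; apply (is_derive_opp (fun y => Rpower y c * psi y)).
      apply (is_derive_mult (fun y => Rpower y c) psi);
        [|apply D; lra | intros; apply Rmult_comm].
      apply is_derive_Reals, derivable_pt_lim_power; lra.
    - intros y Hy.
      assert (E : Rpower y c = Rpower y (c - 1) * y).
      { rewrite <- (Rpower_1 y) at 3 by lra. rewrite <- Rpower_plus. f_equal; ring. }
      rewrite E.
      assert (0 < Rpower y (c - 1)) by apply exp_pos.
      specialize (H y ltac:(lra)); nra. }
  set (eps := Rpower x c * psi x).
  assert (Heps : 0 < eps) by (apply Rmult_lt_0_compat; [apply exp_pos | exact Hp]).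
  assert (C : continuity_pt psi 0).
  { apply continuity_pt_filterlim, (ex_derive_continuous (V := R_NormedModule)).
    eexists; apply D; lra. }
  destruct (C eps Heps) as [d [Hd Cd]].
  (* [t < d] gives [psi t < eps] by continuity at 0, [t <= x] allows [M], and [t < 1] with [c >= 0]
     gives [Rpower t c <= 1]; together they contradict [eps <= Rpower t c * psi t]. *)
  set (t := Rmin (d / 2) (Rmin x (/ 2))).
  assert (Ht : 0 < t /\ t < d /\ t <= x /\ t < 1).
  { unfold t; pose proof (Rmin_l (d / 2) (Rmin x (/ 2))).
    pose proof (Rmin_r (d / 2) (Rmin x (/ 2))).
    pose proof (Rmin_l x (/ 2)). pose proof (Rmin_r x (/ 2)).
    repeat split; try lra. repeat apply Rmin_glb_lt; lra. }
  specialize (M t ltac:(lra)); fold eps in M.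
  assert (Hpt : psi t < eps).
  { assert (T : Rabs (psi t - psi 0) < eps).
    { apply Cd; split; [split; [exact I | lra]|].
      cbn; unfold Rdist; rewrite Rminus_0_r, Rabs_pos_eq; lra. }
    apply Rabs_def2 in T; lra. }
  assert (Ht1 : 0 < Rpower t c <= 1).
  { split; [apply exp_pos|]. unfold Rpower; rewrite <- exp_0.
    assert (ln t < 0) by (rewrite <- ln_1; apply ln_increasing; lra).
    destruct (Req_dec c 0) as [->|]; [rewrite Rmult_0_l; lra|].
    left; apply exp_increasing; nra. }
  nra.
Qed.

(** * The Bessel series *)

(* [J_nu x = (x / 2) ^ nu / Gamma (nu + 1) * bessel_u nu (x ^ 2)] for [x > 0]. *)
Fixpoint bessel_coef (nu : R) (k : nat) : R :=
  match k with
  | O => 1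
  | S k' => - bessel_coef nu k' / (4 * INR (S k') * (INR (S k') + nu))
  end.

Definition bessel_u (nu : R) : R -> R := PSeries (bessel_coef nu).
Definition bessel_du (nu : R) : R -> R := PSeries (PS_derive (bessel_coef nu)).
Definition bessel_ddu (nu : R) : R -> R := PSeries (PS_derive (PS_derive (bessel_coef nu))).

Lemma INR_S_ge_1 (k : nat) : 1 <= INR (S k).
Proof. rewrite S_INR; pose proof (pos_INR k); lra. Qed.

Lemma bessel_coef_neq_0 (nu : R) (k : nat) : -1 < nu -> bessel_coef nu k <> 0.
Proof.
  intros Hnu; induction k as [|k IH]; [cbn; lra|].
  cbn [bessel_coef]; pose proof (INR_S_ge_1 k).
  apply Rmult_integral_contrapositive; split; [lra|].
  apply Rinv_neq_0_compat; nra.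
Qed.

Lemma bessel_coef_radius (nu : R) : -1 < nu -> CV_radius (bessel_coef nu) = p_infty.
Proof.
  intros Hnu; apply CV_radius_infinite_DAlembert.
  - intros n; now apply bessel_coef_neq_0.
  - apply is_lim_seq_ext with (fun k => / 4 * (/ INR (S k) * / (INR (S k) + nu))).
    + intros n; cbn [bessel_coef].
      pose proof (bessel_coef_neq_0 nu n Hnu). pose proof (INR_S_ge_1 n).
      replace (- bessel_coef nu n / (4 * INR (S n) * (INR (S n) + nu)) / bessel_coef nu n)
        with (- (/ 4 * (/ INR (S n) * / (INR (S n) + nu)))) by (field; lra).
      rewrite Rabs_Ropp, Rabs_pos_eq; [reflexivity|].
      left; repeat apply Rmult_lt_0_compat; try apply Rinv_0_lt_compat; lra.
    + assert (L : is_lim_seq (fun k => INR (S k)) p_infty)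
        by apply (is_lim_seq_incr_1 INR p_infty), is_lim_seq_INR.
      replace (Finite 0) with (Finite (/ 4 * (0 * 0))) by (f_equal; ring).
      apply (is_lim_seq_scal_l _ (/ 4) (0 * 0)).
      apply is_lim_seq_mult'.
      * replace (Finite 0) with (Rbar_inv p_infty) by reflexivity.
        apply is_lim_seq_inv; [exact L | discriminate].
      * replace (Finite 0) with (Rbar_inv p_infty) by reflexivity.
        apply is_lim_seq_inv; [|discriminate].
        eapply is_lim_seq_plus; [exact L | apply is_lim_seq_const | reflexivity].
Qed.

Lemma is_derive_bessel_u (nu x : R) : -1 < nu ->
  is_derive (bessel_u nu) x (bessel_du nu x).
Proof.
  intros Hnu; apply is_derive_PSeries; rewrite bessel_coef_radius by exact Hnu; exact I.
Qed.

Lemma is_derive_bessel_du (nu x : R) : -1 < nu ->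
  is_derive (bessel_du nu) x (bessel_ddu nu x).
Proof.
  intros Hnu; apply is_derive_PSeries.
  rewrite CV_radius_derive, bessel_coef_radius by exact Hnu; exact I.
Qed.

(** This is Bessel's equation after the change of variable; coefficient by coefficient it is the
    recursion that defines [bessel_coef]. *)
Lemma bessel_ode (nu x : R) : -1 < nu ->
  x * bessel_ddu nu x + (nu + 1) * bessel_du nu x + / 4 * bessel_u nu x = 0.
Proof.
  intros Hnu; unfold bessel_ddu, bessel_du, bessel_u.
  set (a := bessel_coef nu).
  assert (Ex : forall b, CV_radius b = p_infty -> ex_pseries b x).
  { intros b Hb; apply CV_radius_inside; rewrite Hb; exact I. }
  assert (Ra : CV_radius a = p_infty) by now apply bessel_coef_radius.
  assert (Ra1 : CV_radius (PS_derive a) = p_infty) by now rewrite CV_radius_derive.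
  assert (Ra2 : CV_radius (PS_derive (PS_derive a)) = p_infty) by now rewrite CV_radius_derive.
  assert (X1 : ex_pseries (PS_incr_1 (PS_derive (PS_derive a))) x)
    by (apply Ex; rewrite CV_radius_incr_1; exact Ra2).
  assert (X2 : ex_pseries (PS_scal (nu + 1) (PS_derive a)) x)
    by (apply Ex; rewrite CV_radius_scal; [exact Ra1 | lra]).
  assert (X3 : ex_pseries (PS_scal (/ 4) a) x)
    by (apply Ex; rewrite CV_radius_scal; [exact Ra | lra]).
  rewrite <- PSeries_incr_1, <- !PSeries_scal.
  rewrite <- (PSeries_plus _ _ x X1 X2), <- PSeries_plus.
  - rewrite <- (PSeries_const_0 x); apply PSeries_ext; intros [|k];
      unfold PS_plus, PS_incr_1, PS_scal, PS_derive, plus, scal, zero; cbn -[INR bessel_coef];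
      unfold mult; cbn -[INR bessel_coef]; unfold a; cbn [bessel_coef].
    + rewrite INR_1; field; lra.
    + pose proof (INR_S_ge_1 k); pose proof (INR_S_ge_1 (S k)).
      rewrite (S_INR (S k)) in *. field. repeat split; lra.
  - now apply ex_pseries_plus.
  - exact X3.
Qed.

Lemma bessel_u_0 (nu : R) : bessel_u nu 0 = 1.
Proof. unfold bessel_u; now rewrite PSeries_0. Qed.

Lemma bessel_du_0 (nu : R) : -1 < nu -> bessel_du nu 0 = - / (4 * (nu + 1)).
Proof.
  intros Hnu; unfold bessel_du; rewrite PSeries_0; unfold PS_derive; cbn.
  field; lra.
Qed.

(** * The Rayleigh sums *)

(** A table for course-of-values recursion: stage [n] is meaningful at indices up to [n] only. The
    convolution at [m] reads indices up to [m], so later stages never see the values beyond. *)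
Fixpoint rayleigh_upto (nu : R) (n : nat) : nat -> R :=
  match n with
  | O => fun _ => / (4 * (nu + 1))
  | S m => fun k =>
      if (k <=? m)%nat then rayleigh_upto nu m k
      else PS_mult (rayleigh_upto nu m) (rayleigh_upto nu m) m / (INR (S m) + nu + 1)
  end.

(* [rayleigh nu k] is the sum of [j ^ (- 2 (k + 1))] over the positive zeros [j] of
   [J_nu]; it is defined here by Kishore's convolution recursion. *)
Definition rayleigh (nu : R) (k : nat) : R := rayleigh_upto nu k k.

Lemma rayleigh_upto_eq (nu : R) (n k : nat) :
  (k <= n)%nat -> rayleigh_upto nu n k = rayleigh nu k.
Proof.
  induction n as [|n IH]; intros Hk.
  - replace k with O by lia; reflexivity.
  - destruct (Nat.eq_dec k (S n)) as [->|Hne]; [reflexivity|].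
    cbn [rayleigh_upto]; destruct (Nat.leb_spec k n); [apply IH; lia | lia].
Qed.

Lemma rayleigh_S (nu : R) (n : nat) :
  rayleigh nu (S n) = PS_mult (rayleigh nu) (rayleigh nu) n / (INR (S n) + nu + 1).
Proof.
  unfold rayleigh at 1; cbn [rayleigh_upto].
  destruct (Nat.leb_spec (S n) n); [lia|].
  f_equal; apply sum_eq; intros i Hi; rewrite !rayleigh_upto_eq by lia; reflexivity.
Qed.

(** By strong induction: convolution preserves the order of nonnegative sequences, and the divisor
    [n + 1 + nu + 1] is positive and grows with the order. *)
Lemma rayleigh_mono (mu nu : R) (n : nat) : -1 < nu -> nu <= mu ->
  0 <= rayleigh mu n <= rayleigh nu n.
Proof.
  intros Hnu Hmu; induction n as [n IH] using lt_wf_ind.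
  destruct n as [|n].
  - unfold rayleigh; cbn [rayleigh_upto]; split.
    + left; apply Rinv_0_lt_compat; lra.
    + apply Rinv_le_contravar; lra.
  - rewrite !rayleigh_S; pose proof (INR_S_ge_1 n).
    assert (H1 : 0 <= PS_mult (rayleigh mu) (rayleigh mu) n
                 <= PS_mult (rayleigh nu) (rayleigh nu) n).
    { unfold PS_mult; split.
      - rewrite <- (Rmult_0_l (INR (S n))), <- sum_cte.
        apply sum_Rle; intros k Hk.
        apply Rmult_le_pos; [apply (IH k) | apply (IH (n - k)%nat)]; lia.
      - apply sum_Rle; intros k Hk.
        pose proof (IH k ltac:(lia)); pose proof (IH (n - k)%nat ltac:(lia)).
        apply Rmult_le_compat; lra. }
    split.
    + apply Rmult_le_pos; [lra|]. left; apply Rinv_0_lt_compat; lra.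
    + apply Rmult_le_compat; try lra.
      * left; apply Rinv_0_lt_compat; lra.
      * apply Rinv_le_contravar; lra.
Qed.

Lemma rayleigh_nonneg (nu : R) (n : nat) : -1 < nu -> 0 <= rayleigh nu n.
Proof. intros Hnu; apply (rayleigh_mono nu nu n Hnu); lra. Qed.

(** * The Riccati equation *)

(** Taylor coefficients of [W' + (nu + 1) (W - W(0)) / x - W^2]. When [W(0) = 1 / (4 (nu + 1))],
    this is the defect of [W] in the Riccati equation divided by [x]. *)
Definition riccati_coef (nu : R) (s : nat -> R) (k : nat) : R :=
  (INR (S k) + nu + 1) * s (S k) - PS_mult s s k.

Lemma is_pseries_riccati_coef (nu : R) (s : nat -> R) (x : R) :
  Rbar_lt (Rabs x) (CV_radius s) ->
  is_pseries (riccati_coef nu s) x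
    (PSeries (PS_derive s) x + (nu + 1) * PSeries (PS_decr_1 s) x
     + (-1) * (PSeries s x * PSeries s x)).
Proof.
  intros Rs.
  apply is_pseries_ext with (PS_plus (PS_plus (PS_derive s) (PS_scal (nu + 1) (PS_decr_1 s)))
    (PS_scal (-1) (PS_mult s s))).
  - intros k; change (INR (S k) * s (S k) + (nu + 1) * s (S k) + (-1) * PS_mult s s k
      = riccati_coef nu s k); unfold riccati_coef; ring.
  - apply (is_pseries_plus (V := R_NormedModule)); [apply (is_pseries_plus (V := R_NormedModule))|].
    + apply PSeries_correct, CV_radius_inside; now rewrite CV_radius_derive.
    + apply (is_pseries_scal (V := R_NormedModule)); [apply Rmult_comm|].
      apply PSeries_correct, CV_radius_inside; now rewrite CV_radius_decr_1.
    + apply (is_pseries_scal (V := R_NormedModule)); [apply Rmult_comm|].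
      apply is_pseries_mult; auto; apply PSeries_correct; now apply CV_radius_inside.
Qed.

Lemma riccati_defect (nu : R) (s : nat -> R) (r x : R) : -1 < nu ->
  s O = / (4 * (nu + 1)) -> Rbar_le r (CV_radius s) -> 0 <= x < r ->
  x * PSeries (PS_derive s) x
  = / 4 - (nu + 1) * PSeries s x + x * PSeries s x ^ 2
    + x * PSeries (riccati_coef nu s) x.
Proof.
  intros Hnu Hs0 Hr Hx.
  pose proof (Rabs_lt_CV_radius s r x Hr Hx) as Rs.
  rewrite (is_pseries_unique _ _ _ (is_pseries_riccati_coef nu s x Rs)).
  pose proof (PSeries_decr_1 s x (CV_radius_inside s x Rs)) as E0.
  rewrite Hs0 in E0.
  set (W := PSeries s x) in *; set (W1 := PSeries (PS_decr_1 s) x) in *.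
  replace (/ 4 - (nu + 1) * W) with (- (nu + 1) * (x * W1)) by (rewrite E0; field; lra).
  ring.
Qed.

(* [phi = u' + W u] satisfies [x phi' + (nu + 1) phi = x W phi + x D u], where [D] is
   the defect of [W] in the Riccati equation; the factor [exp (- int W)] removes [x W phi]. *)
Lemma riccati_compare (nu e : R) (s : nat -> R) (r : R) : -1 < nu ->
  s O = / (4 * (nu + 1)) -> Rbar_le r (CV_radius s) ->
  (forall x, 0 <= x < r -> e * PSeries (riccati_coef nu s) x * bessel_u nu x <= 0) ->
  forall x, 0 <= x < r -> e * (bessel_du nu x + PSeries s x * bessel_u nu x) <= 0.
Proof.
  intros Hnu Hs0 Hr HD x Hx.
  set (V := PSeries (PS_Int s)).
  set (phi := fun x => bessel_du nu x + PSeries s x * bessel_u nu x).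
  set (dphi := fun x => bessel_ddu nu x + (PSeries (PS_derive s) x * bessel_u nu x
                          + PSeries s x * bessel_du nu x)).
  assert (DV : forall x, 0 <= x < r -> is_derive V x (PSeries s x)).
  { intros y Hy; now apply is_derive_PS_Int with r. }
  assert (Dphi : forall x, 0 <= x < r -> is_derive phi x (dphi x)).
  { intros y Hy.
    apply (is_derive_plus (bessel_du nu) (fun x => PSeries s x * bessel_u nu x));
      [now apply is_derive_bessel_du|].
    apply (is_derive_mult (PSeries s) (bessel_u nu));
      [|now apply is_derive_bessel_u | intros; apply Rmult_comm].
    apply is_derive_PSeries; exact (Rabs_lt_CV_radius s r y Hr Hy). }
  set (psi := fun x => e * phi x * exp (- V x)).
  set (dpsi := fun x => e * dphi x * exp (- V x) + e * phi x * (- PSeries s x * exp (- V x))).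
  enough (H : psi x <= 0).
  { unfold psi in H; pose proof (exp_pos (- V x)); fold (phi x); nra. }
  apply (singular_compare (nu + 1) r psi dpsi); [lra| | | |exact Hx].
  (* The prescribed value of [s O] is [- u'(0) / u(0)], so [phi] vanishes at the singular point. *)
  - unfold psi, phi; rewrite bessel_du_0, bessel_u_0, PSeries_0, Hs0 by exact Hnu.
    right; ring.
  - intros y Hy; unfold psi, dpsi.
    apply (is_derive_mult (fun x => e * phi x) (fun x => exp (- V x)));
      [| |intros; apply Rmult_comm].
    + apply (is_derive_scal phi); auto.
    + apply (is_derive_comp exp (fun x => - V x)); [apply is_derive_exp|].
      apply (is_derive_opp V); auto.
  - intros y Hy; unfold psi, dpsi.
    assert (E : y * dphi y = - (nu + 1) * phi y + y * PSeries s y * phi y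
                + y * PSeries (riccati_coef nu s) y * bessel_u nu y).
    { unfold dphi, phi.
      pose proof (bessel_ode nu y Hnu) as O.
      pose proof (riccati_defect nu s r y Hnu Hs0 Hr ltac:(lra)) as Q.
      transitivity (y * bessel_ddu nu y + (y * PSeries (PS_derive s) y) * bessel_u nu y
        + y * PSeries s y * bessel_du nu y); [ring|].
      rewrite Q.
      replace (y * bessel_ddu nu y) with (- (nu + 1) * bessel_du nu y - / 4 * bessel_u nu y) by lra.
      ring. }
    replace (y * (e * dphi y * exp (- V y) + e * phi y * (- PSeries s y * exp (- V y))))
      with (e * exp (- V y) * (y * dphi y - y * PSeries s y * phi y)) by ring.
    rewrite E.
    specialize (HD y ltac:(lra)); pose proof (exp_pos (- V y)).
    assert (e * PSeries (riccati_coef nu s) y * bessel_u nu y * (y * exp (- V y)) <= 0) by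
      (assert (0 < y * exp (- V y)) by (apply Rmult_lt_0_compat; lra); nra).
    lra.
Qed.

Definition truncate (N : nat) (s : nat -> R) (k : nat) : R :=
  if (k <=? N)%nat then s k else 0.

Lemma truncate_radius (N : nat) (s : nat -> R) (r : R) : Rbar_le r (CV_radius (truncate N s)).
Proof.
  apply CV_radius_ge; intros x Hx.
  exists (sum_f_R0 (fun k => Rabs (s k * x ^ k)) N); intros n; unfold truncate.
  destruct (Nat.leb_spec n N) as [Hn|Hn].
  - induction N as [|N IH].
    + replace n with O by lia; cbn -[Rabs pow]; lra.
    + cbn [sum_f_R0]; pose proof (Rabs_pos (s (S N) * x ^ S N)).
      destruct (Nat.eq_dec n (S N)) as [->|Hne].
      * pose proof (cond_pos_sum (fun k => Rabs (s k * x ^ k)) N (fun k => Rabs_pos _)); lra.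
      * specialize (IH ltac:(lia)); lra.
  - rewrite Rmult_0_l, Rabs_R0; apply cond_pos_sum; intros; apply Rabs_pos.
Qed.

Lemma riccati_coef_rayleigh (nu : R) (k : nat) : -1 < nu ->
  riccati_coef nu (rayleigh nu) k = 0.
Proof.
  intros Hnu; unfold riccati_coef; rewrite rayleigh_S.
  pose proof (INR_S_ge_1 k); field; lra.
Qed.

(* Truncating discards only nonnegative terms of the convolution, so the truncation is a
   subsolution of the Riccati equation. *)
Lemma riccati_coef_truncate (nu : R) (N k : nat) : -1 < nu ->
  riccati_coef nu (truncate N (rayleigh nu)) k <= 0.
Proof.
  intros Hnu; unfold riccati_coef, truncate at 1.
  destruct (Nat.leb_spec (S k) N) as [Hk|Hk].
  - right; rewrite <- (riccati_coef_rayleigh nu k Hnu); unfold riccati_coef.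
    apply Rplus_eq_compat_l, Ropp_eq_compat, sum_eq; intros i Hi; unfold truncate.
    now rewrite !(proj2 (Nat.leb_le _ _)) by lia.
  - assert (P : forall i, 0 <= truncate N (rayleigh nu) i).
    { intros i; unfold truncate; destruct (i <=? N)%nat; [now apply rayleigh_nonneg | lra]. }
    pose proof (PS_mult_nonneg _ _ k P P); lra.
Qed.

Lemma PSeries_nonpos (a : nat -> R) (x : R) :
  (forall n, a n <= 0) -> 0 <= x -> ex_pseries a x -> PSeries a x <= 0.
Proof.
  intros Ha Hx Ex.
  apply Ropp_le_cancel; rewrite Ropp_0, <- PSeries_opp, <- (PSeries_const_0 x).
  apply Series_le.
  - intros n; pose proof (pow_le x n Hx); specialize (Ha n).
    unfold PS_opp, opp; cbn; nra.
  - apply (ex_pseries_R (PS_opp a) x), ex_pseries_opp, Ex.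
Qed.

(** Truncations are polynomials, so the comparison applies before anything is known about
    convergence of the full series; the bound is uniform in [N]. *)
Lemma rayleigh_truncate_le (nu r x : R) (N : nat) : -1 < nu ->
  (forall x, 0 <= x < r -> 0 <= bessel_u nu x) -> 0 <= x < r ->
  PSeries (truncate N (rayleigh nu)) x * bessel_u nu x <= - bessel_du nu x.
Proof.
  intros Hnu Hu Hx.
  pose proof (truncate_radius N (rayleigh nu) r) as Hr.
  set (s := truncate N (rayleigh nu)) in *.
  assert (H : 1 * (bessel_du nu x + PSeries s x * bessel_u nu x) <= 0); [|lra].
  apply riccati_compare with r; auto.
  intros y Hy; specialize (Hu y Hy).
  assert (PSeries (riccati_coef nu s) y <= 0); [|nra].
  pose proof (Rabs_lt_CV_radius s r y Hr Hy) as Rs.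
  apply PSeries_nonpos; [intros k; now apply riccati_coef_truncate | lra |].
  eexists; now apply is_pseries_riccati_coef.
Qed.

(** * The normalized Dini function *)

Definition dini_lam (nu x : R) : R := bessel_u nu x + 2 * x * bessel_du nu x.

Lemma dini_lam_0 (nu : R) : dini_lam nu 0 = 1.
Proof. unfold dini_lam; rewrite bessel_u_0; ring. Qed.

Lemma is_derive_dini_lam (nu x : R) : -1 < nu ->
  is_derive (dini_lam nu) x (3 * bessel_du nu x + 2 * (x * bessel_ddu nu x)).
Proof.
  intros Hnu.
  pose proof (is_derive_bessel_u nu x Hnu) as D1.
  pose proof (is_derive_bessel_du nu x Hnu) as D2.
  unfold dini_lam; auto_derive.
  - repeat split; eexists; eassumption.
  - rewrite (is_derive_unique (fun x : R => bessel_u nu x) x _ D1),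
      (is_derive_unique (fun x : R => bessel_du nu x) x _ D2); ring.
Qed.

Lemma bessel_u_nonneg (nu r x : R) : -1 < nu ->
  (forall x, 0 <= x < r -> 0 < dini_lam nu x) -> 0 <= x < r -> 0 <= bessel_u nu x.
Proof.
  intros Hnu Hl Hx.
  (* [x u' = (lam - u) / 2 >= - u / 2], that is, [sqrt x * u] is nondecreasing. *)
  assert (H : - bessel_u nu x <= 0); [|lra].
  apply (singular_compare (/ 2) r (fun x => - bessel_u nu x) (fun x => - bessel_du nu x));
    [lra | rewrite bessel_u_0; lra | | | exact Hx].
  - intros y _; apply (is_derive_opp (bessel_u nu)); now apply is_derive_bessel_u.
  - intros y Hy; specialize (Hl y ltac:(lra)); unfold dini_lam in Hl; lra.
Qed.

(** At each [x] in [[0, r)] a term of the series is at most a truncation, which is at most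
    [- u'(x) / u(x)]; bounded terms at every such [x] force the radius to be at least [r]. *)
Lemma rayleigh_radius (nu r : R) : -1 < nu ->
  (forall x, 0 <= x < r -> 0 < dini_lam nu x) -> Rbar_le r (CV_radius (rayleigh nu)).
Proof.
  intros Hnu Hl; apply CV_radius_ge; intros x Hx.
  assert (Hu : forall x, 0 <= x < r -> 0 <= bessel_u nu x)
    by (intros y Hy; now apply bessel_u_nonneg with r).
  assert (Hux : 0 < bessel_u nu x).
  (* If [u(x) = 0], the truncation bound reads [u'(x) <= 0], whence [lam(x) = 2 x u'(x) <= 0]. *)
  { destruct (Hu x Hx) as [|E]; [assumption|exfalso].
    pose proof (rayleigh_truncate_le nu r x O Hnu Hu Hx) as H.
    rewrite <- E, Rmult_0_r in H.
    specialize (Hl x Hx); unfold dini_lam in Hl; rewrite <- E in Hl; nra. }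
  exists (- bessel_du nu x / bessel_u nu x); intros n.
  assert (P : 0 <= rayleigh nu n * x ^ n)
    by (apply Rmult_le_pos; [now apply rayleigh_nonneg | apply pow_le; lra]).
  rewrite Rabs_pos_eq by exact P.
  apply Rle_trans with (PSeries (truncate n (rayleigh nu)) x).
  - replace (rayleigh nu n) with (truncate n (rayleigh nu) n)
      by (unfold truncate; now rewrite Nat.leb_refl).
    apply PSeries_ge_term with r; [|apply truncate_radius|exact Hx].
    intros k; unfold truncate; destruct (k <=? n)%nat; [now apply rayleigh_nonneg | lra].
  - apply Rmult_le_reg_r with (bessel_u nu x); [exact Hux|].
    replace (- bessel_du nu x / bessel_u nu x * bessel_u nu x)
      with (- bessel_du nu x) by (field; lra).
    now apply rayleigh_truncate_le with r.
Qed.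

Lemma bessel_logder (nu r x : R) : -1 < nu ->
  Rbar_le r (CV_radius (rayleigh nu)) -> 0 <= x < r ->
  bessel_du nu x = - PSeries (rayleigh nu) x * bessel_u nu x.
Proof.
  intros Hnu Hr Hx.
  (* The full series has zero defect, so the comparison holds with either sign; [e = 1] and [e = -1]
     give equality. *)
  assert (H : forall e, e * (bessel_du nu x + PSeries (rayleigh nu) x * bessel_u nu x) <= 0).
  { intros e; apply riccati_compare with r; auto.
    intros y _; right.
    rewrite (PSeries_ext _ (fun _ => 0)) by (intros; now apply riccati_coef_rayleigh).
    rewrite PSeries_const_0; ring. }
  pose proof (H 1); pose proof (H (-1)); lra.
Qed.

Lemma rayleigh_riccati (nu r x : R) : -1 < nu ->
  Rbar_le r (CV_radius (rayleigh nu)) -> 0 <= x < r ->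
  x * PSeries (PS_derive (rayleigh nu)) x
  = / 4 - (nu + 1) * PSeries (rayleigh nu) x + x * PSeries (rayleigh nu) x ^ 2.
Proof.
  intros Hnu Hr Hx; rewrite (riccati_defect nu _ r x Hnu) by auto.
  rewrite (PSeries_ext (riccati_coef nu _) (fun _ => 0)) by (intros; now apply riccati_coef_rayleigh).
  rewrite PSeries_const_0; ring.
Qed.

(** Since [u' = - W u], the product of [u] and [exp (int W)] has zero derivative, and it is positive
    at 0. *)
Lemma bessel_u_pos (nu r x : R) : -1 < nu ->
  Rbar_le r (CV_radius (rayleigh nu)) -> 0 <= x < r -> 0 < bessel_u nu x.
Proof.
  intros Hnu Hr Hx.
  set (s := rayleigh nu) in *.
  set (V := PSeries (PS_Int s)).
  assert (DV : forall x, 0 <= x < r -> is_derive V x (PSeries s x)).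
  { intros y Hy; now apply is_derive_PS_Int with r. }
  assert (H : bessel_u nu 0 * exp (V 0) <= bessel_u nu x * exp (V x)).
  { apply (derive_nonneg_le (fun x => bessel_u nu x * exp (V x))
      (fun x => bessel_du nu x * exp (V x) + bessel_u nu x * (PSeries s x * exp (V x)))); [lra| |].
    - intros y Hy.
      apply (is_derive_mult (bessel_u nu) (fun x => exp (V x)));
        [now apply is_derive_bessel_u| |intros; apply Rmult_comm].
      apply (is_derive_comp exp V); [apply is_derive_exp | apply DV; lra].
    - intros y Hy; rewrite (bessel_logder nu r y) by (auto; lra); fold s; right; ring. }
  rewrite bessel_u_0 in H.
  pose proof (exp_pos (V 0)); pose proof (exp_pos (V x)).
  destruct (Rle_lt_dec (bessel_u nu x) 0); [nra | assumption].
Qed.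

Lemma dini_lam_factor (nu r x : R) : -1 < nu ->
  Rbar_le r (CV_radius (rayleigh nu)) -> 0 <= x < r ->
  dini_lam nu x = bessel_u nu x * (1 - PSeries (dini_v (rayleigh nu)) x).
Proof.
  intros Hnu Hr Hx; unfold dini_lam.
  rewrite (bessel_logder nu r x), PSeries_dini_v by auto; ring.
Qed.

Lemma PSeries_derive_dini_v (s : nat -> R) (x : R) : Rbar_lt (Rabs x) (CV_radius s) ->
  PSeries (PS_derive (dini_v s)) x = 2 * PSeries s x + 2 * (x * PSeries (PS_derive s) x).
Proof.
  intros Hx.
  pose proof (is_derive_PSeries s x Hx) as Ds.
  rewrite <- Derive_PSeries by now rewrite CV_radius_dini_v.
  rewrite (Derive_ext _ (fun x => 2 * x * PSeries s x)) by apply PSeries_dini_v.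
  apply is_derive_unique.
  auto_derive; [eexists; exact Ds|].
  rewrite (is_derive_unique (fun x : R => PSeries s x) x _ Ds); ring.
Qed.

(** The Bessel equation eliminates [u''], the Riccati equation eliminates [W'], and [u' = - W u]
    eliminates [u']; what remains is a rational identity in [W], [u] and [x]. *)
Lemma is_derive_dini_lam_P (nu r x : R) : -1 < nu ->
  Rbar_le r (CV_radius (rayleigh nu)) -> 0 <= x < r ->
  PSeries (dini_v (rayleigh nu)) x < 1 ->
  is_derive (dini_lam nu) x (- dini_P (rayleigh nu) x * dini_lam nu x).
Proof.
  intros Hnu Hr Hx Hv.
  replace (- dini_P (rayleigh nu) x * dini_lam nu x)
    with (3 * bessel_du nu x + 2 * (x * bessel_ddu nu x)); [now apply is_derive_dini_lam|].
  rewrite (dini_lam_factor nu r x) by auto; unfold dini_P.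
  rewrite PSeries_derive_dini_v by exact (Rabs_lt_CV_radius _ r x Hr Hx).
  rewrite (rayleigh_riccati nu r x) by auto.
  pose proof (bessel_ode nu x Hnu) as O.
  replace (x * bessel_ddu nu x) with (- (nu + 1) * bessel_du nu x - / 4 * bessel_u nu x) by lra.
  rewrite (bessel_logder nu r x) by auto.
  rewrite PSeries_dini_v in *.
  field; lra.
Qed.

(** [v'(0) = 2 W(0)] and [v(0) = 0], so the value is [3 W(0)]; this is the source of the constant in
    the exponentials of [g_fun] and [q_fun]. *)
Lemma dini_P_rayleigh_0 (nu : R) : -1 < nu -> dini_P (rayleigh nu) 0 = 3 / (4 * (nu + 1)).
Proof.
  intros Hnu; unfold dini_P; rewrite !PSeries_0.
  unfold PS_derive, dini_v, PS_incr_1, PS_scal, scal, zero, rayleigh; cbn; unfold mult; cbn.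
  field; lra.
Qed.

(** The zero sequence plays the part of [mu] at infinity, so that [q_fun] is covered by the same
    result on differences as [g_fun]. *)
Lemma dini_P_zero (x : R) : dini_P (fun _ => 0) x = 0.
Proof.
  unfold dini_P; rewrite PSeries_const_0.
  rewrite (PSeries_ext (PS_derive (dini_v (fun _ => 0))) (fun _ => 0)).
  - rewrite PSeries_const_0; ring.
  - intros n; unfold PS_derive, dini_v, PS_incr_1, PS_scal, scal; cbn -[INR]; unfold mult; cbn -[INR]; ring.
Qed.

(** * Bessel and Dini functions *)

Lemma derivR_eq (f : R -> R) (x l : R) : is_derive f x l -> derivR f x = l.
Proof.
  intros D; apply is_derive_Reals in D.
  apply (uniqueness_limite f x); [|exact D].
  unfold derivR; apply epsilon_spec; eauto.
Qed.

Definition bessel_const (nu : R) : R := / Gamma (nu + 1).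

Lemma bessel_const_pos (nu : R) : -1 < nu -> 0 < bessel_const nu.
Proof. intros Hnu; apply Rinv_0_lt_compat, Gamma_pos; lra. Qed.

(** Both sides have the same ratio of consecutive terms, [- x^2 / (4 (k + 1) (k + 1 + nu))], by the
    functional equation of Gamma. *)
Lemma bessel_term_eq (nu x : R) (k : nat) : -1 < nu -> 0 < x ->
  bessel_term nu x k
  = bessel_const nu * Rpower (x / 2) nu * (bessel_coef nu k * (x ^ 2) ^ k).
Proof.
  intros Hnu Hx; induction k as [|k IH].
  - unfold bessel_term, bessel_const; cbn -[Rpower].
    replace (2 * 0 + nu) with nu by ring. replace (0 + nu + 1) with (nu + 1) by ring.
    pose proof (Gamma_pos (nu + 1) ltac:(lra)); field; lra.
  - pose proof (pos_INR k).
    pose proof (Gamma_pos (INR k + nu + 1) ltac:(lra)).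
    assert (Hf : INR (fact k) <> 0) by apply INR_fact_neq_0.
    transitivity (bessel_term nu x k * (- x ^ 2 / (4 * INR (S k) * (INR (S k) + nu)))).
    + unfold bessel_term.
      rewrite fact_simpl, mult_INR, S_INR.
      replace (INR k + 1 + nu + 1) with ((INR k + nu + 1) + 1) by ring.
      rewrite Gamma_succ by lra.
      replace (2 * (INR k + 1) + nu) with ((2 * INR k + nu) + INR 2) by (cbn; ring).
      rewrite Rpower_plus, Rpower_pow by lra.
      cbn [pow]; field; repeat split; lra.
    + rewrite IH; cbn [bessel_coef].
      change ((x ^ 2) ^ S k) with (x ^ 2 * (x ^ 2) ^ k).
      rewrite S_INR; field; lra.
Qed.

Lemma BesselJ_eq (nu x : R) : -1 < nu -> 0 < x ->
  BesselJ nu x = bessel_const nu * Rpower (x / 2) nu * bessel_u nu (x ^ 2).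
Proof.
  intros Hnu Hx.
  assert (H : infinite_sum (bessel_term nu x)
                (bessel_const nu * Rpower (x / 2) nu * bessel_u nu (x ^ 2))).
  { apply is_series_Reals.
    apply is_series_ext with
      (fun k => bessel_const nu * Rpower (x / 2) nu * (bessel_coef nu k * (x ^ 2) ^ k)).
    - intros k; symmetry; now apply bessel_term_eq.
    - apply (is_series_scal (V := R_NormedModule) (bessel_const nu * Rpower (x / 2) nu)
               (fun k => bessel_coef nu k * (x ^ 2) ^ k) (bessel_u nu (x ^ 2))).
      apply (is_pseries_R (bessel_coef nu)), PSeries_correct, CV_radius_inside.
      rewrite bessel_coef_radius by exact Hnu; exact I. }
  apply (uniqueness_sum (bessel_term nu x)); [|exact H].
  unfold BesselJ; apply epsilon_spec; eauto.
Qed.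

(** Differentiating the power in [x * J'] produces [nu * J], which cancels against [(1 - nu) * J]
    and leaves [u + 2 x^2 u'] at [x^2]. *)
Lemma dini_eq (nu x : R) : -1 < nu -> 0 < x ->
  dini nu x = bessel_const nu * Rpower (x / 2) nu * dini_lam nu (x ^ 2).
Proof.
  intros Hnu Hx; unfold dini.
  rewrite (derivR_eq _ _ (bessel_const nu *
     (nu * Rpower (x / 2) (nu - 1) * / 2 * bessel_u nu (x ^ 2)
      + Rpower (x / 2) nu * (2 * x * bessel_du nu (x ^ 2))))).
  - rewrite BesselJ_eq by assumption; unfold dini_lam.
    assert (E : Rpower (x / 2) nu = Rpower (x / 2) (nu - 1) * (x / 2)).
    { rewrite <- (Rpower_1 (x / 2)) at 3 by lra. rewrite <- Rpower_plus; f_equal; ring. }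
    rewrite E; field.
  - apply is_derive_ext_loc with
      (fun y => bessel_const nu * (Rpower (y / 2) nu * bessel_u nu (y ^ 2))).
    { generalize (open_gt 0 x Hx); apply filter_imp; intros y Hy.
      rewrite BesselJ_eq by assumption; symmetry; apply Rmult_assoc. }
    apply (is_derive_scal (fun y => Rpower (y / 2) nu * bessel_u nu (y ^ 2))).
    apply (is_derive_mult (fun y => Rpower (y / 2) nu) (fun y => bessel_u nu (y ^ 2)));
      [| |intros; apply Rmult_comm].
    + replace (nu * Rpower (x / 2) (nu - 1) * / 2)
        with (/ 2 * (nu * Rpower (x / 2) (nu - 1))) by ring.
      apply (is_derive_comp (fun y => Rpower y nu) (fun y => y / 2)).
      * apply is_derive_Reals, derivable_pt_lim_power; lra.
      * auto_derive; [exact I | field].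
    + apply (is_derive_comp (bessel_u nu) (fun y => y ^ 2)).
      * now apply is_derive_bessel_u.
      * auto_derive; [exact I | ring].
Qed.

Lemma dini_sqrt_eq (nu x : R) : -1 < nu -> 0 < x ->
  dini nu (sqrt x)
  = bessel_const nu * exp (- nu * ln 2) * Rpower x (nu / 2) * dini_lam nu x.
Proof.
  intros Hnu Hx.
  pose proof (sqrt_lt_R0 x Hx) as Hs.
  rewrite dini_eq, pow2_sqrt by (assumption || lra).
  assert (L : ln (sqrt x) = ln x / 2).
  { rewrite <- (sqrt_sqrt x) at 2 by lra. rewrite ln_mult by assumption; field. }
  unfold Rpower; rewrite ln_div, L by lra.
  replace (nu * (ln x / 2 - ln 2)) with (- nu * ln 2 + nu / 2 * ln x) by field.
  rewrite exp_plus; ring.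
Qed.

(** A zero of [lam] at [y > 0] is a zero of [dini nu] at [sqrt y], so [lam] has none below [a ^ 2];
    it is continuous with value 1 at 0. *)
Lemma dini_lam_pos (nu a x : R) : -1 < nu -> first_pos_zero (dini nu) a ->
  0 <= x < a ^ 2 -> 0 < dini_lam nu x.
Proof.
  intros Hnu [Ha [_ Hz]] Hx.
  assert (NZ : forall y, 0 <= y < a ^ 2 -> dini_lam nu y <> 0).
  { intros y Hy E.
    destruct (Req_dec y 0) as [->|]; [rewrite dini_lam_0 in E; lra|].
    apply (Hz (sqrt y)).
    - split; [apply sqrt_lt_R0; lra|].
      rewrite <- (sqrt_pow2 a) by lra; apply sqrt_lt_1_alt; lra.
    - rewrite dini_sqrt_eq, E by lra; ring. }
  destruct (Rle_lt_dec (dini_lam nu x) 0) as [H|]; [exfalso|assumption].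
  destruct (IVT_gen (dini_lam nu) 0 x 0) as [c [Hc E]].
  - intros y; apply continuity_pt_filterlim, (ex_derive_continuous (V := R_NormedModule)).
    eexists; now apply is_derive_dini_lam.
  - rewrite dini_lam_0, Rmin_right, Rmax_left; lra.
  - rewrite Rmin_left, Rmax_right in Hc by lra.
    apply (NZ c); [lra | exact E].
Qed.

(** * Values at 0 and the three functions *)

(** [G] is differentiable, hence continuous, at 0, so [G 0] is the limit of [h] there; uniqueness of
    limits identifies it with the value chosen by [epsilon]. *)
Lemma abs_monotonic_extend0 (r : R) (h G : R -> R) : 0 < r ->
  abs_mono (fun x => 0 <= x < r) G -> (forall x, 0 < x < r -> h x = G x) ->
  abs_monotonic (fun x => 0 <= x < r) (extend0 h).
Proof.
  intros Hr HG E.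
  apply abs_mono_monotonic with G; [exact HG|].
  intros x Hx; unfold extend0; destruct (Rlt_dec 0 x) as [Hp|Hn]; [symmetry; apply E; lra|].
  replace x with 0 by lra.
  assert (L : limit1_in h (fun t => 0 < t) (G 0) 0).
  { destruct HG as [S [SG HS]]; destruct (HS G SG) as [_ [G' [_ D]]].
    assert (C : continuity_pt G 0).
    { apply continuity_pt_filterlim, (ex_derive_continuous (V := R_NormedModule)).
      eexists; apply D; lra. }
    intros eps Heps; destruct (C eps Heps) as [d [Hd Cd]].
    exists (Rmin d r); split; [now apply Rmin_glb_lt|].
    intros t [Ht Htd]; cbn in Htd |- *; unfold Rdist in Htd.
    rewrite Rminus_0_r, Rabs_pos_eq in Htd by lra.
    pose proof (Rmin_l d r); pose proof (Rmin_r d r).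
    rewrite E by lra; apply Cd; split; [split; [exact I | lra]|].
    cbn; unfold Rdist; rewrite Rminus_0_r, Rabs_pos_eq; lra. }
  apply (single_limit h (fun t => 0 < t) _ _ 0); [|exact L|].
  - intros alp Halp; exists (alp / 2); unfold Rdist.
    rewrite Rminus_0_r, Rabs_pos_eq; lra.
  - apply epsilon_spec; eauto.
Qed.

Theorem theorem2 (mu nu a : R) :
  -1 < nu -> nu <= mu -> first_pos_zero (dini nu) a ->
  abs_monotonic (fun x => 0 <= x < a ^ 2) (extend0 (g_fun mu nu)) /\
  abs_monotonic (fun x => 0 <= x < a ^ 2) (extend0 (f_fun mu nu)) /\
  abs_monotonic (fun x => 0 <= x < a ^ 2) (extend0 (q_fun nu)).
Proof.
  intros Hnu Hmu Ha.
  assert (Hmu1 : -1 < mu) by lra.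
  assert (Hr : 0 < a ^ 2) by (apply pow_lt, Ha).
  assert (Hl : forall x, 0 <= x < a ^ 2 -> 0 < dini_lam nu x)
    by (intros; now apply dini_lam_pos with a).
  set (r := a ^ 2) in *; set (s := rayleigh nu); set (t := rayleigh mu).
  assert (Hst : forall n, 0 <= t n <= s n) by (intros; now apply rayleigh_mono).
  assert (Rs : Rbar_le r (CV_radius s)) by now apply rayleigh_radius.
  assert (Rt : Rbar_le r (CV_radius t)) by now apply CV_radius_le_compat with s.
  assert (Vs : forall x, 0 <= x < r -> PSeries (dini_v s) x < 1).
  (* [lam = u (1 - v)] with both [lam] and [u] positive forces [v < 1]. *)
  { intros x Hx; specialize (Hl x Hx).
    rewrite (dini_lam_factor nu r x) in Hl by assumption.
    pose proof (bessel_u_pos nu r x Hnu Rs Hx); fold s in Hl; nra. }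
  assert (Vt : forall x, 0 <= x < r -> PSeries (dini_v t) x < 1).
  { intros x Hx; pose proof (dini_v_bounds r s t Hst Rs x Hx); specialize (Vs x Hx); lra. }
  (* Since [v] for [mu] lies below [v] for [nu], positivity carries over to [mu] on the same
     interval without locating the zeros of [dini mu]. *)
  assert (Hlm : forall x, 0 <= x < r -> 0 < dini_lam mu x).
  { intros x Hx; rewrite (dini_lam_factor mu r x) by assumption.
    apply Rmult_lt_0_compat; [now apply bessel_u_pos with r|].
    specialize (Vt x Hx); fold t; lra. }
  assert (Dl : forall x, 0 <= x < r ->
    is_derive (dini_lam nu) x (- dini_P s x * dini_lam nu x))
    by (intros x Hx; apply is_derive_dini_lam_P with r; auto).
  assert (Dlm : forall x, 0 <= x < r ->
    is_derive (dini_lam mu) x (- dini_P t x * dini_lam mu x))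
    by (intros x Hx; apply is_derive_dini_lam_P with r; auto).
  pose proof (bessel_const_pos nu Hnu) as Kn.
  pose proof (bessel_const_pos mu Hmu1) as Km.
  set (f := fun x => (dini_P s x - dini_P t x) - (dini_P s 0 - dini_P t 0)).
  assert (Af : abs_mono (fun x => 0 <= x < r) f) by now apply abs_mono_dini_P_diff.
  (* [c = dini_P t 0 - dini_P s 0], so the factor [exp (c * x)] makes the logarithmic derivative of
     [G] equal to [f], which vanishes at 0. *)
  set (c := 3 / (4 * (mu + 1)) - 3 / (4 * (nu + 1))).
  set (G := fun x => bessel_const mu * exp (- mu * ln 2)
                     / (bessel_const nu * exp (- nu * ln 2))
                     * (exp (c * x) * dini_lam mu x / dini_lam nu x)).
  assert (GP : forall x, 0 <= x < r -> 0 < G x).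
  { intros x Hx; unfold G; apply Rmult_lt_0_compat; apply Rdiv_lt_0_compat;
      try apply Rmult_lt_0_compat; auto using exp_pos. }
  assert (DG : forall x, 0 <= x < r -> is_derive G x (f x * G x)).
  { intros x Hx; specialize (Hl x Hx).
    unfold G; auto_derive.
    - repeat split; [eexists; now apply Dlm | eexists; now apply Dl | lra].
    - rewrite (is_derive_unique (fun x : R => dini_lam mu x) x _ (Dlm x Hx)),
        (is_derive_unique (fun x : R => dini_lam nu x) x _ (Dl x Hx)).
      unfold f, s, t; rewrite !dini_P_rayleigh_0 by assumption; fold s t; unfold c.
      pose proof (exp_pos (- nu * ln 2)).
      field; repeat split; lra. }
  assert (EG : forall x, 0 < x < r -> g_fun mu nu x = G x).
  { intros x Hx; unfold g_fun, G.
    rewrite !dini_sqrt_eq by lra.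
    specialize (Hl x ltac:(lra)).
    assert (E : Rpower x (nu / 2) = Rpower x ((nu - mu) / 2) * Rpower x (mu / 2))
      by (rewrite <- Rpower_plus; f_equal; field).
    rewrite E.
    replace (3 * x / 4 * (1 / (mu + 1) - 1 / (nu + 1))) with (c * x) by (unfold c; field; lra).
    pose proof (exp_pos (- nu * ln 2)).
    assert (0 < Rpower x ((nu - mu) / 2)) by apply exp_pos.
    assert (0 < Rpower x (mu / 2)) by apply exp_pos.
    field; lra. }
  split; [|split].
  - apply abs_monotonic_extend0 with G; [exact Hr| |exact EG].
    apply abs_mono_logder with f; [exact Af | intros x Hx; left; now apply GP | exact DG].
  - apply abs_monotonic_extend0 with f; [exact Hr | exact Af|].
    intros x Hx; unfold f_fun; apply derivR_eq.
    apply is_derive_ext_loc with (fun y => ln (G y)).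
    (* [g_fun] and [G] agree only on the open interval, so the derivative of the logarithm is
       transferred through a neighbourhood of [x]. *)
    + assert (L : locally x (fun y => 0 < y /\ y < r)).
      { apply filter_and; [now apply (open_gt 0) | now apply (open_lt r)]. }
      revert L; apply filter_imp; intros y Hy; now rewrite EG.
    + pose proof (GP x ltac:(lra)) as P.
      replace (f x) with ((f x * G x) * / G x) by (field; lra).
      apply (is_derive_comp ln G); [now apply is_derive_ln | apply DG; lra].
  - set (fq := fun x => (dini_P s x - dini_P (fun _ => 0) x)
                        - (dini_P s 0 - dini_P (fun _ => 0) 0)).
    set (Q := fun x => / (bessel_const nu * exp (- nu * ln 2))
                       * (exp (- (3 / (4 * (nu + 1))) * x) / dini_lam nu x)).
    apply abs_monotonic_extend0 with Q; [exact Hr| |].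
    + apply abs_mono_logder with fq.
      * apply abs_mono_dini_P_diff; auto.
        intros n; specialize (Hst n); lra.
      * intros x Hx; left; apply Rmult_lt_0_compat.
        -- apply Rinv_0_lt_compat, Rmult_lt_0_compat; auto using exp_pos.
        -- apply Rdiv_lt_0_compat; auto using exp_pos.
      * intros x Hx; specialize (Hl x Hx).
        unfold Q; auto_derive.
        -- repeat split; [eexists; now apply Dl | lra].
        -- rewrite (is_derive_unique (fun x : R => dini_lam nu x) x _ (Dl x Hx)).
           unfold fq; rewrite !dini_P_zero; unfold s; rewrite dini_P_rayleigh_0 by assumption.
           pose proof (exp_pos (- nu * ln 2)).
           field; repeat split; lra.
    + intros x Hx; unfold q_fun, Q.
      rewrite dini_sqrt_eq by lra.
      specialize (Hl x ltac:(lra)).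
      replace (- (3 * x) / (4 * (nu + 1))) with (- (3 / (4 * (nu + 1))) * x) by (field; lra).
      pose proof (exp_pos (- nu * ln 2)).
      assert (0 < Rpower x (nu / 2)) by apply exp_pos.
      field; lra.
Qed.
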